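(* Let $(u_i)_{i\in\mathbb{N}}$ be real numbers with $\sum_{i=1}^M u_i^2>0$ for every $M\in\mathbb{N}$, and suppose there exist $\beta>1$, $\beta'>0$ and $c>0$ (possibly depending on $\beta,\beta'$) such that $$\frac{\sum_{i=B}^M u_i^2}{\sum_{i=1}^M u_i^2}\le\frac{c}{M^{\beta'}}\quad\text{for all }M\in\mathbb{N},\qquad B=\big\lfloor(M^{1/\beta}-1)^\beta\big\rfloor.$$ Let $(E_{ij})_{i,j\in\mathbb{N}}$ be centered i.i.d. real random variables with variance $\sigma^2$ and finite fourth moment, let $E_M:=M^{-1/2}(E_{ij})_{i,j\le M}$, and let $\tilde u_M:=\big(\sum_{i=1}^M u_i^2\big)^{-1/2}(u_1,\dots,u_M)^T$. Then $$\tilde u_M^T E_ME_M^T\tilde u_M\longrightarrow\sigma^2\quad\text{almost surely as }M\to\infty.$$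
   Context: $\lfloor x\rfloor$ is the largest integer $\le x$. *)

(* Defs.v *)
From HB Require Import structures.
From mathcomp Require Import all_boot all_order all_algebra.
From mathcomp Require Import all_classical all_reals all_analysis.
Set Implicit Arguments. Unset Strict Implicit. Unset Printing Implicit Defensive.
Import Order.TTheory GRing.Theory Num.Theory.
Import numFieldNormedType.Exports.
Local Open Scope classical_set_scope.
Local Open Scope ring_scope.

Definition mutually_independent d (T : measurableType d) (R : realType)
  (P : probability T R) (I : eqType) (X : I -> {RV P >-> R}) : Prop :=
  forall (s : seq I) (A : I -> set R), uniq s ->
    (forall i, measurable (A i)) ->
    P (\big[setI/setT]_(i <- s) (X i @^-1` A i)) =
    (\prod_(i <- s) P (X i @^-1` A i))%E.

Definition identically_distributed d (T : measurableType d) (R : realType)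
  (P : probability T R) (I : Type) (X : I -> {RV P >-> R}) (Y : {RV P >-> R}) : Prop :=
  forall i (A : set R), measurable A -> P (X i @^-1` A) = P (Y @^-1` A).

(* S_M = sum_{i=1}^M u_i^2 (u is indexed from 1; u 0 is unused). *)
Definition sumsq (R : realType) (u : nat -> R) (M : nat) : R :=
  \sum_(1 <= i < M.+1) u i ^+ 2.

Definition Bidx (R : realType) (beta : R) (M : nat) : int :=
  Num.floor (powR (powR (M%:R) beta^-1 - 1) beta).

Definition tailsq (R : realType) (u : nat -> R) (beta : R) (M : nat) : R :=
  \sum_(1 <= i < M.+1 | (Bidx beta M <= i%:Z)%R) u i ^+ 2.

(* E_M = M^{-1/2} (E_ij)_{i,j<=M}; E i j (0-indexed) stands for E_{i+1,j+1}. *)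
Definition Emat d (T : measurableType d) (R : realType) (P : probability T R)
  (E : nat -> nat -> {RV P >-> R}) (M : nat) (t : T) : 'M[R]_M :=
  \matrix_(i < M, j < M) ((Num.sqrt (M%:R))^-1 * E i j t).

Definition utilde (R : realType) (u : nat -> R) (M : nat) : 'cV[R]_M :=
  \col_(i < M) ((Num.sqrt (sumsq u M))^-1 * u i.+1).

Definition quadform d (T : measurableType d) (R : realType) (P : probability T R)
  (E : nat -> nat -> {RV P >-> R}) (u : nat -> R) (M : nat) (t : T) : R :=
  ((utilde u M)^T *m Emat E M t *m (Emat E M t)^T *m utilde u M) ord0 ord0.

(* Main.v *)
(** Write [S_M] for [sumsq u M] and [D_M] for the sum over [j <= M] of
    [(sum_(i <= M) u_i E_ij)^2 - sigma^2 S_M], so that the quadratic form minus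
    [sigma^2] is [D_M / (M S_M)]. Expanding the squares, [D_M] is a linear
    combination of the products [E_ij E_i'j] ([i < i' <= M]) and
    [E_ij^2 - sigma^2], which are pairwise orthogonal in L^2 with bounded second
    moments. Hence, for [a <= M],
      [E[((D_M - D_a) / (M S_M))^2] <= C ((M - a) / M^2 + (S_M - S_a) / (M S_M))].
    With [a = 0] the bound is of order [1/M], which is summable along
    [M_k = floor(k^beta)], so [D_(M_k) / (M_k S_(M_k)) -> 0] almost surely. For
    general [M] take [a = M_k] with [k = floor(M^(1/beta))]: then
    [M - a = O(M^(1 - 1/beta))], and [B <= a <= M], so the tail hypothesis gives
    [(S_M - S_a) / S_M <= c / M^beta']. Both terms are now summable over all [M],
    and no maximal inequality is needed to control the gaps. *)

Require Import Defs.
From HB Require Import structures.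
From mathcomp Require Import all_boot all_order all_algebra.
From mathcomp Require Import all_classical all_reals all_analysis.
From mathcomp Require Import measurable_realfun zify ring lra.
Import Order.TTheory GRing.Theory Num.Theory.
Import numFieldNormedType.Exports.
Import HBNNSimple.
Local Open Scope classical_set_scope.
Local Open Scope ring_scope.

(** * Products of independent random variables *)

(** A nonnegative [f] is an increasing limit of simple functions, so monotone convergence reduces
    the claim to simple functions, and linearity reduces it to the indicators in the hypothesis.
    Integrability of [W] keeps the right factor finite, so it can be pulled through the limit. *)
Lemma ge0_integral_compM d (T : measurableType d) (R : realType)
    (P : probability T R) (X : {RV P >-> R}) (W : T -> R) :
  (forall t, 0 <= W t) -> P.-integrable setT (EFin \o W) ->
  (forall A, measurable A ->
    \int[P]_t (\1_A (X t) * W t)%:E = P (X @^-1` A) * \int[P]_t (W t)%:E)%E ->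
  forall f : R -> R, measurable_fun setT f -> (forall x, 0 <= f x) ->
  (\int[P]_t (f (X t) * W t)%:E
    = \int[P]_t (f (X t))%:E * \int[P]_t (W t)%:E)%E.
Proof.
move=> W0 iW hA f mf f0.
have mW : measurable_fun setT W by apply/measurable_EFinP; exact: measurable_int iW.
have mEf : measurable_fun setT (EFin \o f) by exact/measurable_EFinP.
have Ef0 x : [set: R] x -> (0 <= (EFin \o f) x)%E by rewrite lee_fin.
pose h := nnsfun_approx measurableT mEf.
have mX : measurable_fun setT X by exact: measurable_funPT.
have mhX n : measurable_fun setT (h n \o X).
  by apply: measurableT_comp => //; exact: measurable_funPT.
have hcvg x : (h n x)%:E @[n --> \oo] --> (f x)%:E.
  exact: (cvg_nnsfun_approx measurableT mEf Ef0).
have hnd x m n : (m <= n)%N -> h m x <= h n x.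
  by move=> mn; exact/lefP/nd_nnsfun_approx.
have h1 : (\int[P]_t (h n (X t))%:E)%E @[n --> \oo] --> (\int[P]_t (f (X t))%:E)%E.
  have -> : (\int[P]_t (f (X t))%:E = \int[P]_t (limn (fun n => (h n (X t))%:E)))%E.
    by apply: eq_integral => t _; apply/esym/cvg_lim.
  apply: cvg_monotone_convergence => //.
  - by move=> n; exact/measurable_EFinP/mhX.
  - by move=> n t _; rewrite lee_fin.
  - by move=> t _ m n mn; rewrite lee_fin hnd.
have h2 : (\int[P]_t (h n (X t) * W t)%:E)%E @[n --> \oo] -->
    (\int[P]_t (f (X t) * W t)%:E)%E.
  have -> : (\int[P]_t (f (X t) * W t)%:E
      = \int[P]_t (limn (fun n => (h n (X t) * W t)%:E)))%E.
    apply: eq_integral => t _; apply/esym/cvg_lim => //.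
    under eq_fun do rewrite EFinM.
    by rewrite EFinM; apply: cvgeZr.
  apply: cvg_monotone_convergence => //.
  - by move=> n; apply/measurable_EFinP; apply: measurable_funM => //; exact: mhX.
  - by move=> n t _; rewrite lee_fin mulr_ge0.
  - by move=> t _ m n mn; rewrite lee_fin ler_wpM2r ?hnd.
have fW : (\int[P]_t (W t)%:E)%E \is a fin_num by exact: integrable_fin_num.
have h3 : (\int[P]_t (h n (X t))%:E * \int[P]_t (W t)%:E)%E @[n --> \oo] -->
    (\int[P]_t (f (X t))%:E * \int[P]_t (W t)%:E)%E by apply: cvgeZr.
suff suf n : (\int[P]_t (h n (X t) * W t)%:E =
    \int[P]_t (h n (X t))%:E * \int[P]_t (W t)%:E)%E.
  have h4 := cvg_lim (@ereal_hausdorff R) h2; rewrite -h4.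
  apply: cvg_lim; first exact: ereal_hausdorff.
  by under eq_fun do rewrite suf.
have mpre r : measurable (h n @^-1` [set r]).
  by rewrite -[X in measurable X]setTI; apply: measurable_funPT.
have mi r : measurable_fun setT (fun t => \1_(h n @^-1` [set r]) (X t) : R).
  apply: measurableT_comp => //; exact: measurable_indic.
have rn0 r t : 0 <= r * \1_(h n @^-1` [set r]) (X t).
  rewrite indicE; case: (boolP (_ \in _)) => [|_]; last by rewrite mulr0.
  by rewrite inE/= => <-; rewrite mulr1.
have i0 A x : 0 <= \1_A x :> R by rewrite indicE; case: (_ \in _).
have rng r : r \in range (h n) -> 0 <= r by rewrite inE => -[x _ <-].
(* Splitting [h n] over its finitely many level sets reduces the left integral to [hA] at each of
   them; the integral of [h n] along [X] is split the same way below. *)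
transitivity (\sum_(r \in range (h n)) (r%:E * (P (X @^-1` (h n @^-1` [set r]))
     * \int[P]_t (W t)%:E)))%E.
  transitivity (\int[P]_t (\sum_(r \in range (h n))
      (r * \1_(h n @^-1` [set r]) (X t) * W t)%:E))%E.
    apply: eq_integral => t _; rewrite fsumEFin//; congr EFin.
    by rewrite {1}(fimfunE (h n) (X t)) mulr_fsuml.
  rewrite ge0_integral_fsum//; last 2 first.
  - move=> r; apply/measurable_EFinP; apply: measurable_funM => //.
    exact: measurable_funM.
  - by move=> r t _; rewrite lee_fin mulr_ge0.
  apply: eq_fsbigr => r rr.
  rewrite -hA//.
  under eq_integral do rewrite -mulrA EFinM.
  rewrite ge0_integralZl//.
  - by apply/measurable_EFinP; apply: measurable_funM.
  - by move=> t _; rewrite lee_fin mulr_ge0.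
  - by rewrite lee_fin rng.
have -> : (\int[P]_t (h n (X t))%:E =
    \sum_(r \in range (h n)) (r%:E * P (X @^-1` (h n @^-1` [set r]))))%E.
  transitivity (\int[P]_t (\sum_(r \in range (h n))
      (r * \1_(h n @^-1` [set r]) (X t))%:E))%E.
    apply: eq_integral => t _; rewrite fsumEFin//; congr EFin.
    by rewrite {1}(fimfunE (h n) (X t)).
  rewrite ge0_integral_fsum//; last 2 first.
  - by move=> r; apply/measurable_EFinP; apply: measurable_funM.
  - by move=> r t _; rewrite lee_fin.
  apply: eq_fsbigr => r rr.
  under eq_integral do rewrite EFinM.
  rewrite ge0_integralZl//.
  - congr (_ * _)%E.
    have -> : (fun t => (\1_(h n @^-1` [set r]) (X t))%:E) =
      EFin \o \1_(X @^-1` (h n @^-1` [set r])) :> (T -> \bar R).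
      by apply/funext.
    rewrite integral_indic ?setIT//.
    by rewrite -[X in measurable X]setTI; apply: mX.
  - exact/measurable_EFinP.
  - by rewrite lee_fin rng.
rewrite -[in LHS](fineK fW).
rewrite -[in RHS](fineK fW).
(* Nonnegativity is demanded at every real [r]; a negative [r] has an empty level set and a zero
   term. *)
rewrite ge0_mule_fsuml//; last first.
  move=> r.
  have [r0|r0] := leP 0 r; first by rewrite mule_ge0.
  rewrite (_ : h n @^-1` [set r] = set0); last first.
    by apply/seteqP; split=> x//= hx; move: r0; rewrite -hx ltNge => /negP; apply.
  by rewrite preimage_set0 measure0 mule0.
by apply: eq_fsbigr => r _; rewrite muleA.
Qed.

Lemma prode_fin_num (R : realType) (I : eqType) (s : seq I) (a : I -> \bar R) :
  (forall i, i \in s -> a i \is a fin_num) ->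
  (\prod_(i <- s) a i)%E \is a fin_num.
Proof.
move=> h; rewrite big_seq; elim/big_ind: _ => //.
by move=> x y; exact: fin_numM.
Qed.

Lemma measurable_prod_comp d (T : measurableType d) (R : realType)
    (P : probability T R) (I : eqType) (X : I -> {RV P >-> R}) (s : seq I)
    (f : I -> R -> R) :
  (forall i, measurable_fun setT (f i)) ->
  measurable_fun setT (fun t => \prod_(i <- s) f i (X i t)).
Proof.
move=> mf; apply: measurable_prod => i _.
by apply: measurableT_comp => //; exact: measurable_funPT.
Qed.

Lemma ge0_integrable d (T : measurableType d) (R : realType)
    (P : probability T R) (f : T -> R) :
  measurable_fun setT f -> (forall t, 0 <= f t) ->
  (\int[P]_t (f t)%:E)%E \is a fin_num -> P.-integrable setT (EFin \o f).
Proof.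
move=> mf f0 fin; apply/integrableP; split; first exact/measurable_EFinP.
under eq_integral do rewrite /= ger0_norm//.
by rewrite ltey_eq fin.
Qed.

(** A zero-one function is the indicator of its level set at 1, so the product is the indicator of
    an intersection and the product rule for events applies directly. *)
Lemma integral_prod_indep_zero_one d (T : measurableType d) (R : realType)
    (P : probability T R) (I : eqType) (X : I -> {RV P >-> R}) (s : seq I)
    (f : I -> R -> R) :
  mutually_independent X -> uniq s ->
  (forall i, measurable_fun setT (f i)) ->
  (forall i, i \in s -> forall x, f i x = 0 \/ f i x = 1) ->
  (\int[P]_t (\prod_(i <- s) f i (X i t))%:E
    = \prod_(i <- s) \int[P]_t (f i (X i t))%:E)%E.
Proof.
move=> hind us mf f01.
pose A i := f i @^-1` [set 1].
have mA i : measurable (A i).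
  by rewrite -[X in measurable X]setTI; apply: mf.
have mXA i : measurable (X i @^-1` A i).
  by rewrite -[X in measurable X]setTI; apply: measurable_funPT.
have fE i t : i \in s -> f i (X i t) = \1_(X i @^-1` A i) t.
  move=> /f01 /(_ (X i t)) f01i; rewrite indicE.
  case: f01i => fi; rewrite fi.
    by rewrite memNset// /A /= fi => /esym/eqP; rewrite oner_eq0.
  by rewrite mem_set// /A /= fi.
transitivity (\int[P]_t (\1_(\big[setI/setT]_(i <- s) (X i @^-1` A i)) t)%:E)%E.
  apply: eq_integral => t _; congr EFin.
  rewrite (eq_big_seq (fun i => \1_(X i @^-1` A i) t)); last first.
    by move=> i; exact: fE.
  elim: (s) => [|i r ih]; first by rewrite !big_nil indicT.
  by rewrite !big_cons indicI ih.
rewrite integral_indic ?setIT//; last first.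
  by apply: big_ind => //; exact: measurableI.
transitivity (\prod_(i <- s) P (X i @^-1` A i))%E; first exact: hind.
apply: eq_big_seq => i si.
rewrite -[X in P X]setIT -integral_indic//.
by apply: eq_integral => t _; rewrite /= fE.
Qed.

(* Induction on [s1] replaces indicators by arbitrary nonnegative functions one
   variable at a time, so only the product rule for events is needed and no
   monotone class argument. *)
Lemma ge0_integral_prod_indep_mixed d (T : measurableType d) (R : realType)
    (P : probability T R) (I : eqType) (X : I -> {RV P >-> R})
    (s1 s2 : seq I) (f : I -> R -> R) :
  mutually_independent X -> uniq (s1 ++ s2) ->
  (forall i, measurable_fun setT (f i)) ->
  (forall i x, 0 <= f i x) ->
  (forall i, P.-integrable setT (EFin \o (f i \o X i))) ->
  (forall i, i \in s2 -> forall x, f i x = 0 \/ f i x = 1) ->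
  (\int[P]_t (\prod_(i <- s1 ++ s2) f i (X i t))%:E
    = \prod_(i <- s1 ++ s2) \int[P]_t (f i (X i t))%:E)%E.
Proof.
move=> hind; elim: s1 s2 f => [|p s1 ih] s2 f us mf f0 fi f01.
  exact: integral_prod_indep_zero_one.
have /andP[ps us'] : (p \notin s1 ++ s2) && uniq (s1 ++ s2) by [].
have ihW := ih s2 f us' mf f0 fi f01.
have W0 t : 0 <= \prod_(i <- s1 ++ s2) f i (X i t) by exact: prodr_ge0.
rewrite cat_cons.
under eq_integral do rewrite big_cons.
rewrite big_cons -ihW.
apply: ge0_integral_compM => //.
  apply: ge0_integrable => //; first exact: measurable_prod_comp.
  rewrite ihW; apply: prode_fin_num => i _.
  by have /integrable_fin_num := fi i; apply.
move=> A mA.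
(* The indicator of [A] makes [p] a zero-one index, so the induction hypothesis applies to [s1] and
   [p :: s2]. *)
pose g i := if i == p then \1_A else f i.
have gE i : i \in s1 ++ s2 -> g i = f i.
  by rewrite /g; case: eqP => // -> psi; rewrite psi in ps.
have pE : perm_eq (s1 ++ p :: s2) (p :: s1 ++ s2).
  by rewrite -cat1s perm_catCA.
have mg i : measurable_fun setT (g i).
  by rewrite /g; case: ifP => // _; exact: measurable_indic.
have mXA : measurable (X p @^-1` A).
  by rewrite -[X in measurable X]setTI; apply: measurable_funPT.
have := ih (p :: s2) g; rewrite (perm_uniq pE) => /(_ us mg).
move=> /(_ _ _ _)/wrap[].
- by move=> i x; rewrite /g; case: ifP.
- move=> i; rewrite /g; case: ifPn => // /eqP ->.
  rewrite (_ : _ \o _ = EFin \o \1_(X p @^-1` A))//.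
  exact: integrable_indic.
- move=> i; rewrite inE => /orP[/eqP ->|si] x; rewrite /g.
    by rewrite eqxx indicE; case: (_ \in _); [right|left].
  case: ifPn => [_|_]; last exact: f01.
  by rewrite indicE; case: (_ \in _); [right|left].
under eq_integral do rewrite (perm_big _ pE) big_cons /=.
rewrite (perm_big _ pE) big_cons /=.
rewrite [X in (_ = _ * X)%E](eq_big_seq (fun i => \int[P]_t (f i (X i t))%:E)%E);
  last by move=> i /gE ->.
rewrite -ihW => h.
transitivity (\int[P]_t (g p (X p t) * \prod_(j <- s1 ++ s2) g j (X j t))%:E)%E.
  apply: eq_integral => t _; congr EFin; congr (_ * _).
    by rewrite /g eqxx.
  by apply: eq_big_seq => i /gE ->.
rewrite h; congr (_ * _)%E.
transitivity (\int[P]_t (\1_(X p @^-1` A) t)%:E)%E.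
  by apply: eq_integral => t _; rewrite /g eqxx.
by rewrite integral_indic// setIT.
Qed.

Lemma ge0_integral_prod_indep d (T : measurableType d) (R : realType)
    (P : probability T R) (I : eqType) (X : I -> {RV P >-> R})
    (s : seq I) (f : I -> R -> R) :
  mutually_independent X -> uniq s ->
  (forall i, measurable_fun setT (f i)) ->
  (forall i x, 0 <= f i x) ->
  (forall i, P.-integrable setT (EFin \o (f i \o X i))) ->
  (\int[P]_t (\prod_(i <- s) f i (X i t))%:E
    = \prod_(i <- s) \int[P]_t (f i (X i t))%:E)%E.
Proof.
move=> hind us mf f0 fi.
by have := @ge0_integral_prod_indep_mixed _ _ _ P _ X s [::] f hind; rewrite cats0; apply.
Qed.

(** The absolute value of the product is a product of absolute values, whose integral factors by the
    nonnegative case into finite numbers. *)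
Lemma integrable_prod_indep d (T : measurableType d) (R : realType)
    (P : probability T R) (I : eqType) (X : I -> {RV P >-> R})
    (s : seq I) (f : I -> R -> R) :
  mutually_independent X -> uniq s ->
  (forall i, measurable_fun setT (f i)) ->
  (forall i, P.-integrable setT (EFin \o (f i \o X i))) ->
  P.-integrable setT (EFin \o (fun t => \prod_(i <- s) f i (X i t))).
Proof.
move=> hind us mf fi.
have ifn i : P.-integrable setT (EFin \o ((fun x => `|f i x|) \o X i)).
  rewrite (_ : EFin \o _ = abse \o (EFin \o (f i \o X i)))//.
  exact: integrable_abse.
apply/integrableP; split; first exact/measurable_EFinP/measurable_prod_comp.
under eq_integral do rewrite /= normr_prod.
have /= -> := @ge0_integral_prod_indep _ _ _ P _ X s (fun i x => `|f i x|) hind us.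
- rewrite ltey_eq prode_fin_num// => i _.
  by have /integrable_fin_num := ifn i; apply.
- by move=> i; apply: measurableT_comp.
- by [].
- exact: ifn.
Qed.

Lemma integral_prod_indep d (T : measurableType d) (R : realType)
    (P : probability T R) (I : eqType) (X : I -> {RV P >-> R})
    (s : seq I) (f : I -> R -> R) :
  mutually_independent X -> uniq s ->
  (forall i, measurable_fun setT (f i)) ->
  (forall i, P.-integrable setT (EFin \o (f i \o X i))) ->
  (\int[P]_t (\prod_(i <- s) f i (X i t))%:E
    = \prod_(i <- s) \int[P]_t (f i (X i t))%:E)%E.
Proof.
move=> hind us mf fi.
(* Factors of arbitrary sign are confined to [s1]; the induction moves its head into the nonnegative
   block [s2]. *)
suff H s1 s2 g : uniq (s1 ++ s2) -> (forall i, measurable_fun setT (g i)) ->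
    (forall i, P.-integrable setT (EFin \o (g i \o X i))) ->
    (forall i, i \notin s1 -> forall x, 0 <= g i x) ->
    (\int[P]_t (\prod_(i <- s1 ++ s2) g i (X i t))%:E
      = \prod_(i <- s1 ++ s2) \int[P]_t (g i (X i t))%:E)%E.
  (* Zero factors off [s] satisfy the sign condition required outside [s1 = s]. *)
  pose g i := if i \in s then f i else cst 0.
  have := H s [::] g; rewrite cats0 => /(_ us) h.
  have fg i : i \in s -> g i = f i by rewrite /g => ->.
  transitivity (\int[P]_t (\prod_(i <- s) g i (X i t))%:E)%E.
    by apply: eq_integral => t _; congr EFin; apply: eq_big_seq => i /fg ->.
  rewrite h.
  - by apply: eq_big_seq => i /fg ->.
  - by move=> i; rewrite /g; case: ifP => // _; exact: measurable_cst.
  - move=> i; rewrite /g; case: ifP => // _.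
    by rewrite (_ : EFin \o _ = cst 0%E)//; exact: integrable0.
  - by move=> i /negbTE si x; rewrite /g si.
elim: s1 s2 g => [|p s1 ih] s2 g us' mg gi g0.
  by apply: ge0_integral_prod_indep => // i; apply: g0.
have /andP[ps us''] : (p \notin s1 ++ s2) && uniq (s1 ++ s2) by [].
have pE : perm_eq (s1 ++ p :: s2) (p :: s1 ++ s2).
  by rewrite -cat1s perm_catCA.
(* With a nonnegative [h] in place of [g p], the index [p] may join [s2], where the induction
   hypothesis is available. *)
have key (h : R -> R) : measurable_fun setT h -> (forall x, 0 <= h x) ->
    P.-integrable setT (EFin \o (h \o X p)) ->
    P.-integrable setT (EFin \o (fun t => h (X p t) *
        \prod_(i <- s1 ++ s2) g i (X i t))) /\
    (\int[P]_t (h (X p t) * \prod_(i <- s1 ++ s2) g i (X i t))%:E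
      = \int[P]_t (h (X p t))%:E *
        \prod_(i <- s1 ++ s2) \int[P]_t (g i (X i t))%:E)%E.
  move=> mh h0 hi; pose g' i := if i == p then h else g i.
  have gE i : i \in s1 ++ s2 -> g' i = g i.
    by rewrite /g'; case: eqP => // -> psi; rewrite psi in ps.
  have mg' i : measurable_fun setT (g' i) by rewrite /g'; case: ifP.
  have ig' i : P.-integrable setT (EFin \o (g' i \o X i)).
    by rewrite /g'; case: ifPn => // /eqP ->.
  have EE t : h (X p t) * \prod_(i <- s1 ++ s2) g i (X i t) =
      \prod_(i <- s1 ++ p :: s2) g' i (X i t).
    rewrite (perm_big _ pE) big_cons /g' eqxx; congr (_ * _).
    by apply: eq_big_seq => i /gE; rewrite /g' => ->.
  split.
    rewrite (_ : (fun t => _) = (fun t => \prod_(i <- s1 ++ p :: s2) g' i (X i t))).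
      by apply: integrable_prod_indep => //; rewrite (perm_uniq pE).
    by apply/funext => t; exact: EE.
  under eq_integral do rewrite EE.
  rewrite ih// ?(perm_uniq pE)//.
    rewrite (perm_big _ pE) big_cons /=; congr (_ * _)%E.
      by rewrite /g' eqxx.
    by apply: eq_big_seq => i /gE ->.
  move=> i si; rewrite /g'; case: ifPn => // ip; apply: g0.
  by rewrite inE negb_or ip.
(* Positive and negative parts are dominated by the absolute value of [g p]; [key] handles each and
   linearity recombines them. *)
pose gp x := Num.max (g p x) 0.
pose gn x := Num.max (- g p x) 0.
have gpn x : g p x = gp x - gn x.
  by rewrite /gp /gn; case: (leP (g p x) 0); case: (leP (- g p x) 0); lra.
have mgp : measurable_fun setT gp by apply: measurable_maxr.
have mgn : measurable_fun setT gn.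
  by apply: measurable_maxr => //; exact: measurableT_comp.
have gp0 x : 0 <= gp x by rewrite /gp le_max lexx orbT.
have gn0 x : 0 <= gn x by rewrite /gn le_max lexx orbT.
have mX : measurable_fun setT (X p) by exact: measurable_funPT.
have igp : P.-integrable setT (EFin \o (gp \o X p)).
  apply: (le_integrable measurableT _ _ (gi p)).
    by apply/measurable_EFinP; apply: measurableT_comp.
  move=> t _ /=; rewrite lee_fin ger0_norm//.
  by rewrite /gp ge_max ler_norm normr_ge0.
have ign : P.-integrable setT (EFin \o (gn \o X p)).
  apply: (le_integrable measurableT _ _ (gi p)).
    by apply/measurable_EFinP; apply: measurableT_comp.
  move=> t _ /=; rewrite lee_fin ger0_norm//.
  by rewrite /gn ge_max -normrN ler_norm normr_ge0.
have [i1 e1] := key gp mgp gp0 igp.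
have [i2 e2] := key gn mgn gn0 ign.
rewrite cat_cons big_cons.
transitivity (\int[P]_t ((gp (X p t) * \prod_(i <- s1 ++ s2) g i (X i t))%:E -
    (gn (X p t) * \prod_(i <- s1 ++ s2) g i (X i t))%:E))%E.
  by apply: eq_integral => t _; rewrite big_cons gpn mulrBl EFinB.
rewrite integralB// e1 e2.
rewrite -muleBl//.
- congr (_ * _)%E; rewrite -integralB//.
  by apply: eq_integral => t _; rewrite gpn EFinB.
- apply: prode_fin_num => i _; by have /integrable_fin_num := gi i; apply.
- apply: fin_num_adde_defr.
  by have /integrable_fin_num := igp; apply.
Qed.

(** * Summable second moments and orthogonal families *)

Lemma nneseries_lty (R : realType) (v : nat -> R) :
  (forall n, 0 <= v n) -> cvgn (series v) ->
  (\sum_(0 <= n <oo) (v n)%:E < +oo)%E.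
Proof.
move=> v0 cv.
rewrite (_ : (\sum_(0 <= n <oo) (v n)%:E)%E = (limn (series v))%:E) ?ltry//.
rewrite -EFin_lim//; congr (limn _); apply/funext => n /=.
by rewrite /series /= sumEFin.
Qed.

(** Integrating termwise, the sum of the [Z n t ^+ 2] has finite integral, hence is finite almost
    surely, and the terms of a convergent series tend to 0. *)
Lemma ae_cvg0_summable_second_moment d (T : measurableType d) (R : realType)
    (P : probability T R) (Z : nat -> T -> R) (v : nat -> R) :
  (forall n, measurable_fun setT (Z n)) ->
  (forall n, (\int[P]_t (Z n t ^+ 2)%:E <= (v n)%:E)%E) ->
  cvgn (series v) ->
  {ae P, forall t, Z n t @[n --> \oo] --> (0 : R)}.
Proof.
move=> mZ Zv cv.
have mZ2 n : measurable_fun setT (fun t => (Z n t ^+ 2)%:E).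
  by apply/measurable_EFinP; apply: measurable_funX.
have Z20 n t : (0 <= (Z n t ^+ 2)%:E)%E by rewrite lee_fin sqr_ge0.
have v0 n : 0 <= v n.
  by rewrite -lee_fin; apply: le_trans (Zv n); apply: integral_ge0.
have S0 t : (0 <= \sum_(0 <= n <oo) (Z n t ^+ 2)%:E)%E by exact: nneseries_ge0.
have iS : P.-integrable setT (fun t => \sum_(0 <= n <oo) (Z n t ^+ 2)%:E)%E.
  apply/integrableP; split; first exact: ge0_emeasurable_sum.
  under eq_integral do rewrite gee0_abs//.
  rewrite integral_nneseries//.
  apply: le_lt_trans (nneseries_lty _ _ v0 cv).
  by apply: lee_nneseries => // n _ _; apply: integral_ge0.
apply: filterS (integrable_ae measurableT iS) => t /(_ I) fin.
have cs : cvgn (series (fun n => Z n t ^+ 2)).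
  by apply: nnseries_is_cvg => [n|]; [exact: sqr_ge0|rewrite ltey_eq fin].
have /cvgr0Pnorm_lt c0 := cvg_series_cvg_0 cs.
apply/cvgr0Pnorm_lt => e e0.
have e20 : 0 < e ^+ 2 by rewrite exprn_gt0.
apply: filterS (c0 _ e20) => n.
rewrite normrX ltr_pXn2r// ?nnegrE//.
exact: ltW.
Qed.

(** Only the diagonal survives when the square is expanded. Orthogonality is asked only between
    nonzero coefficients because the family is later indexed by all triples, where exchanging [i]
    and [i'] repeats the same product. *)
Lemma orthogonal_second_moment_le d (T : measurableType d) (R : realType)
    (P : probability T R) (I : finType) (phi : I -> T -> R) (c : I -> R)
    (K : R) :
  (forall x y, P.-integrable setT (fun t => (phi x t * phi y t)%:E)) ->
  (forall x y, c x != 0 -> c y != 0 -> x != y ->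
    (\int[P]_t (phi x t * phi y t)%:E = 0)%E) ->
  (forall x, (\int[P]_t (phi x t * phi x t)%:E <= K%:E)%E) ->
  (\int[P]_t ((\sum_x c x * phi x t) ^+ 2)%:E <= (K * \sum_x c x ^+ 2)%:E)%E.
Proof.
move=> iphi orth phiK.
have -> : (\int[P]_t ((\sum_x c x * phi x t) ^+ 2)%:E =
    \int[P]_t \sum_(p : I * I)
      ((c p.1 * c p.2)%:E * (phi p.1 t * phi p.2 t)%:E))%E.
  apply: eq_integral => t _.
  under [RHS]eq_bigr do rewrite -EFinM.
  rewrite sumEFin; congr EFin; rewrite expr2 big_distrlr /= pair_big /=.
  by apply: eq_bigr => p _; rewrite mulrACA.
rewrite integral_sum//; last first.
  by move=> p; apply: integrableZl.
rewrite -(pair_big xpredT xpredT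
  (fun x y => (\int[P]_t ((c x * c y)%:E * (phi x t * phi y t)%:E)))%E) /=.
rewrite mulr_sumr -sumEFin; apply: lee_sum => x _.
rewrite (bigD1 x)//= big1 ?adde0.
  rewrite integralZl// -expr2 (mulrC K) [X in (_ <= X)%E]EFinM lee_wpmul2l//.
  by rewrite lee_fin sqr_ge0.
move=> y yx; rewrite integralZl//.
have [->|cx] := eqVneq (c x) 0; first by rewrite mul0r mul0e.
have [->|cy] := eqVneq (c y) 0; first by rewrite mulr0 mul0e.
by rewrite orth ?mule0// eq_sym.
Qed.

(** * p-series and Bernoulli's inequality *)

Lemma is_cvg_series_powR (R : realType) (a : R) : 0 < a ->
  cvgn (series (fun n : nat => (n%:R : R) `^ (- (1 + a)))).
Proof.
move=> a0.
pose v (n : nat) := (n%:R : R) `^ (- (1 + a)).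
have v0 n : 0 <= v n by exact: powR_ge0.
apply: nondecreasing_is_cvgn.
  by apply: nondecreasing_series => n _ _; exact: v0.
(* [k^(-1-a) <= ((k-1)^(-a) - k^(-a)) / a], from [expR x >= 1 + x] and
   [ln (1 - 1/k) <= - 1/k], makes the partial sums telescope. *)
have step (k : nat) : v k.+2 <=
    a^-1 * ((k.+1%:R : R) `^ (- a) - (k.+2%:R : R) `^ (- a)).
  have k1 : (0 : R) < k.+1%:R by rewrite ltr0n.
  have k2 : (0 : R) < k.+2%:R by rewrite ltr0n.
  have k2n : (k.+2%:R : R) != 0 by rewrite gt_eqF.
  have -> : v k.+2 = (k.+2%:R : R) `^ (- a) * (k.+2%:R)^-1.
    rewrite /v opprD addrC powRD ?k2n ?implybT//; congr (_ * _).
    by rewrite powR_inv1// ltW.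
  rewrite ler_pdivlMl// mulrCA.
  have -> : (k.+1%:R : R) `^ (- a) =
      (k.+2%:R : R) `^ (- a) * expR (- a * ln (k.+1%:R / k.+2%:R)).
    rewrite -[in LHS](@divfK _ (k.+2%:R : R) k2n k.+1%:R) mulrC powRM//.
    by congr (_ * _); rewrite /powR gt_eqF// divr_gt0.
  rewrite -[X in _ <= _ - X]mulr1 -mulrBr ler_wpM2l ?powR_ge0//.
  rewrite lerBrDl; apply: le_trans (expR_ge1Dx _).
  rewrite lerD2l mulNr -mulrN ler_pM2l//.
  rewrite lerNr.
  have -> : (k.+1%:R / k.+2%:R : R) = 1 + (- (k.+2%:R)^-1).
    by rewrite -[k.+1%:R](addrK 1) natr1 mulrBl divff// mul1r.
  by apply: le_ln1Dx; rewrite ltrN2 invf_lt1// ltr1n.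
(* The telescoping bound starts at index 2 and gives at most [a^-1]; the first two terms are kept as
   they are. *)
exists (1 + v 0%N + v 1%N + a^-1) => _ [n _ <-].
rewrite /series /=.
have ai : 0 < a^-1 by rewrite invr_gt0.
have [|n2] := leqP n 2.
  case: n => [|[|[|//]]] _; rewrite ?big_nat_recr//= ?big_geq//;
    have := v0 0%N; have := v0 1%N; rewrite /v; lra.
rewrite (big_cat_nat (n := 2))//=; last exact: ltnW.
rewrite big_nat_recr//= big_nat1.
have tel : \sum_(2 <= i < n) v i <= a^-1.
  have -> : \sum_(2 <= i < n) v i = \sum_(0 <= i < n - 2) v i.+2.
    rewrite -{1}[2%N]add0n big_addn; apply: eq_bigr => i _.
    by rewrite addn2.
  apply: (@le_trans _ _ (a^-1 * \sum_(0 <= i < n - 2)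
      ((i.+1%:R : R) `^ (- a) - (i.+2%:R : R) `^ (- a)))).
    by rewrite mulr_sumr ler_sum.
  rewrite -[leRHS]mulr1 ler_wpM2l ?invr_ge0 ?(ltW a0)//.
  under eq_bigr do rewrite -opprB.
  rewrite sumrN (telescope_sumr (fun i => (i.+1%:R : R) `^ (- a)))// opprB.
  by rewrite powR1 lerBlDr lerDl powR_ge0.
by have := v0 0%N; have := v0 1%N; rewrite -/(v 0%N) -/(v 1%N); lra.
Qed.

Lemma bernoulli_nat (R : realFieldType) (x : R) (n : nat) : 0 <= x <= 1 ->
  1 - n%:R * x <= (1 - x) ^+ n.
Proof.
move=> /andP[x0 x1]; elim: n => [|n ih]; first by rewrite mul0r subr0 expr0.
rewrite exprS; apply: (@le_trans _ _ ((1 - x) * (1 - n%:R * x))).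
  have n0 : (0 : R) <= n%:R by [].
  by rewrite -natr1; nra.
by rewrite ler_wpM2l// subr_ge0.
Qed.

(** For a base in ]0, 1] the power decreases in the exponent, so [b] may be raised to the integer
    [n]. The price is a larger constant, harmless for the order of the gaps. *)
Lemma bernoulli_powR (R : realType) (x b : R) (n : nat) : 0 <= x <= 1 ->
  0 < b <= n%:R -> 1 - n%:R * x <= (1 - x) `^ b.
Proof.
move=> /andP[x0 x1] /andP[b0 bn].
have n1 : 1 <= (n%:R : R).
  by rewrite ler1n -(ltr0n R); exact: lt_le_trans bn.
have [->|xn1] := eqVneq x 1.
  by rewrite mulr1 subrr powR0 ?gt_eqF// subr_le0.
have x1' : 0 < 1 - x by rewrite subr_gt0 lt_neqAle xn1.
apply: (le_trans (@bernoulli_nat _ x n _)); first by rewrite x0.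
rewrite -powR_mulrn ?(ltW x1')//; apply: ger_powR => //.
by rewrite x1' lerBlDr lerDl.
Qed.

(** * Degree-two products of the entries *)

Lemma ge0_integral_identically_distributed d (T : measurableType d)
    (R : realType) (P : probability T R) (I : Type) (X : I -> {RV P >-> R})
    (Y : {RV P >-> R}) (i : I) (f : R -> R) :
  identically_distributed X Y -> measurable_fun setT f ->
  (forall x, 0 <= f x) ->
  (\int[P]_t (f (X i t))%:E = \int[P]_t (f (Y t))%:E)%E.
Proof.
move=> hid mf f0.
have mEf : measurable_fun setT (EFin \o f) by exact/measurable_EFinP.
have Ef0 x : (0 <= (EFin \o f) x)%E by rewrite lee_fin.
have := ge0_integral_distribution (X i) mEf Ef0 => /= <-.
have := ge0_integral_distribution Y mEf Ef0 => /= <-.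
by apply: eq_measure_integral => A mA _; exact: hid.
Qed.

Lemma integrable_identically_distributed d (T : measurableType d)
    (R : realType) (P : probability T R) (I : Type) (X : I -> {RV P >-> R})
    (Y : {RV P >-> R}) (i : I) (f : R -> R) :
  identically_distributed X Y -> measurable_fun setT f ->
  P.-integrable setT (EFin \o (f \o Y)) ->
  P.-integrable setT (EFin \o (f \o X i)).
Proof.
move=> hid mf /integrableP[_ fY]; apply/integrableP; split.
  by apply/measurable_EFinP; apply: measurableT_comp => //; exact: measurable_funPT.
rewrite /=.
rewrite (@ge0_integral_identically_distributed _ _ _ P I X Y i
  (fun x => `|f x|) hid)//.
exact: measurableT_comp.
Qed.

Lemma integral_identically_distributed d (T : measurableType d)
    (R : realType) (P : probability T R) (I : Type) (X : I -> {RV P >-> R})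
    (Y : {RV P >-> R}) (i : I) (f : R -> R) :
  identically_distributed X Y -> measurable_fun setT f ->
  P.-integrable setT (EFin \o (f \o Y)) ->
  (\int[P]_t (f (X i t))%:E = \int[P]_t (f (Y t))%:E)%E.
Proof.
move=> hid mf fY.
have mEf : measurable_fun setT (EFin \o f) by exact/measurable_EFinP.
have fX := @integrable_identically_distributed _ _ _ P I X Y i f hid mf fY.
have := @integral_distribution _ _ _ _ _ P (X i) _ mEf fX => /= <-.
have := @integral_distribution _ _ _ _ _ P Y _ mEf fY => /= <-.
by apply: eq_measure_integral => A mA _; exact: hid.
Qed.

(* Monic polynomials of degree 0, 1, 2, each of degree >= 1 being centered for
   a centered law of variance [s]; degrees above 2 never occur. *)
Definition centered_poly (R : realType) (s : R) (k : nat) (x : R) : R :=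
  match k with 0%N => 1 | 1%N => x | _ => x ^+ 2 - s end.

Lemma measurable_centered_poly (R : realType) (s : R) (k : nat) :
  measurable_fun setT (@centered_poly R s k).
Proof.
case: k => [|[|k]] /=; first exact: measurable_cst.
  exact: measurable_id.
by apply: measurable_funB => //; apply: measurable_funX.
Qed.

(** One quadratic bound for all degrees: a product of two such polynomials is then controlled by the
    fourth moment. *)
Lemma centered_poly_le (R : realType) (s : R) (k : nat) (x : R) : 0 <= s ->
  `|centered_poly R s k x| <= (1 + s) * (1 + x ^+ 2).
Proof.
move=> s0; have x2 := sqr_ge0 x.
have x1 : `|x| <= 1 + x ^+ 2.
  rewrite ler_norml; apply/andP.
  by split; have := sqr_ge0 (x - 1); have := sqr_ge0 (x + 1); nra.
case: k => [|[|k]] /=.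
- by rewrite normr1; nra.
- by apply: (le_trans x1); nra.
- by rewrite ler_norml; apply/andP; split; nra.
Qed.

Section moments.
Variables (d : measure_display) (T : measurableType d) (R : realType).
Variables (P : probability T R) (Y : {RV P >-> R}) (sigma : R).
Hypothesis h4 : P.-integrable setT (EFin \o (fun t => Y t ^+ 4)).
Hypothesis hmean : ('E_P[Y] = 0)%E.
Hypothesis hvar : ('V_P[Y] = (sigma ^+ 2)%:E)%E.

Let q := centered_poly R (sigma ^+ 2).

Lemma integrable_centered_polyM (k l : nat) :
  P.-integrable setT (EFin \o ((fun x => q k x * q l x) \o Y)).
Proof.
have mY : measurable_fun setT Y by exact: measurable_funPT.
(* The square comes from multiplying two bounds [centered_poly_le], the 2 from
   [(1 + y)^2 <= 2 (1 + y^2)] at [y = Y t ^+ 2]. *)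
pose C := (1 + sigma ^+ 2) ^+ 2 * 2.
have iB : P.-integrable setT (EFin \o (fun t => C * (1 + Y t ^+ 4))).
  rewrite (_ : EFin \o _ =
    (fun t => C%:E * (EFin \o (fun t => (1 + Y t ^+ 4)%R)) t)%E); last first.
    by apply/funext => t /=; rewrite EFinM.
  apply: integrableZl => //.
  rewrite (_ : EFin \o _ =
    (cst 1 \+ (EFin \o (fun t => (Y t ^+ 4)%R)))%E); last first.
    by apply/funext => t /=; rewrite EFinD.
  apply: integrableD => //.
  by apply: finite_measure_integrable_cst.
apply: (le_integrable measurableT _ _ iB).
  apply/measurable_EFinP; apply: measurableT_comp => //.
  by apply: measurable_funM; exact: measurable_centered_poly.
move=> t _ /=; rewrite lee_fin normrM.
have s0 : 0 <= sigma ^+ 2 by exact: sqr_ge0.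
apply: (le_trans (ler_pM _ _ (centered_poly_le R _ k (Y t) s0)
  (centered_poly_le R _ l (Y t) s0))) => //.
rewrite ger0_norm.
  rewrite /C (_ : Y t ^+ 4 = (Y t ^+ 2) ^+ 2); last by rewrite -exprM.
  set y := Y t ^+ 2; set z := 1 + sigma ^+ 2.
  rewrite mulrACA -expr2 -mulrA ler_wpM2l ?sqr_ge0//.
  by have := sqr_ge0 (1 - y); nra.
rewrite /C !mulr_ge0 ?sqr_ge0// addr_ge0// (_ : Y t ^+ 4 = (Y t ^+ 2) ^+ 2).
  exact: sqr_ge0.
by rewrite -exprM.
Qed.

Lemma integral_centered_poly_eq0 (k : nat) : (0 < k)%N ->
  (\int[P]_t (q k (Y t))%:E = 0)%E.
Proof.
case: k => [//|[|k]] _.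
  by move: hmean; rewrite unlock.
have i2 : P.-integrable setT (EFin \o (fun t => Y t ^+ 2)).
  have := integrable_centered_polyM 1 1; rewrite (_ : _ \o _ = (fun t => Y t ^+ 2))//.
transitivity (\int[P]_t ((Y t ^+ 2)%:E - (sigma ^+ 2)%:E))%E.
  by apply: eq_integral => t _; rewrite -EFinB.
rewrite integralB//; last exact: finite_measure_integrable_cst.
have := expectation_cst P (sigma ^+ 2); rewrite unlock => ->.
move: hvar; rewrite /variance unlock hmean /= unlock => v.
have -> : (\int[P]_t (Y t ^+ 2)%:E = (sigma ^+ 2)%:E)%E.
  by rewrite -v; apply: eq_integral => t _ /=; rewrite expr2 !fctE /= subr0.
by rewrite -EFinD subrr.
Qed.
End moments.

(* For [i <= i'] these are the degree-two terms of column [j]. Two of them with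
   different sets of entries are orthogonal because some entry occurs in exactly
   one of them, and there as a centered factor. *)
Definition chaos d (T : measurableType d) (R : realType) (P : probability T R)
    (E : nat -> nat -> {RV P >-> R}) (s : R) (i i' j : nat) (t : T) : R :=
  if i == i' then E i j t ^+ 2 - s else E i j t * E i' j t.

(** Multiplicity of the entry [p] in the product [E_ij E_i'j]; it is 2 at [(i, j)] when [i = i']. *)
Definition chaos_deg (i i' j : nat) (p : nat * nat) : nat :=
  (p == (i, j)) + (p == (i', j)).

Lemma chaos_deg_eq0 (i i' j : nat) (p : nat * nat) :
  (chaos_deg i i' j p == 0%N) = (p \notin [:: (i, j); (i', j)]).
Proof.
rewrite /chaos_deg addn_eq0 !eqb0 !inE negb_or.
by [].
Qed.

(** Entries of degree 0 contribute the factor 1, so [r] may be any duplicate-free list containing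
    both entries. Two terms can thus be factored over one common list. *)
Lemma chaosE d (T : measurableType d) (R : realType) (P : probability T R)
    (E : nat -> nat -> {RV P >-> R}) (s : R) (i i' j : nat)
    (r : seq (nat * nat)) (t : T) :
  uniq r -> (i, j) \in r -> (i', j) \in r ->
  chaos _ _ _ _ E s i i' j t =
  \prod_(p <- r) centered_poly R s (chaos_deg i i' j p) (E p.1 p.2 t).
Proof.
move=> ur ri ri'; rewrite /chaos; have [<-|ii'] := eqVneq i i'.
  rewrite (bigD1_seq (i, j))//= /chaos_deg eqxx /= big1 ?mulr1// => p pij.
  by rewrite (negbTE pij).
have ii2 : (i', j) != (i, j) by rewrite xpair_eqE eqxx andbT eq_sym.
rewrite (bigD1_seq (i, j))//= -big_filter (bigD1_seq (i', j))/=; last 2 first.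
- by rewrite mem_filter ii2.
- exact: filter_uniq.
rewrite /chaos_deg !eqxx (negbTE ii2) eq_sym (negbTE ii2) /= big_filter_cond big1.
  by rewrite mulr1.
by move=> p /andP[p1 p2]; rewrite (negbTE p1) (negbTE p2).
Qed.

(** The orderings [i <= i'] and [k <= k'] turn an equality of unordered pairs into an equality of
    indices. *)
Lemma chaos_support_inj (i i' j k k' l : nat) : (i <= i')%N -> (k <= k')%N ->
  [:: (i, j); (i', j)] =i [:: (k, l); (k', l)] -> [/\ i = k, i' = k' & j = l].
Proof.
move=> ii' kk' h.
have := h (i, j); rewrite !inE eqxx /= !xpair_eqE => /esym/orP e1.
have := h (i', j); rewrite !inE eqxx orbT /= !xpair_eqE => /esym/orP e2.
have := h (k, l); rewrite !inE eqxx /= !xpair_eqE => /orP e3.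
have := h (k', l); rewrite !inE eqxx orbT /= !xpair_eqE => /orP e4.
have jl : j = l by case: e1 => /andP[_ /eqP].
have i1 : i = k \/ i = k' by case: e1 => /andP[/eqP ? _]; [left|right].
have i2 : i' = k \/ i' = k' by case: e2 => /andP[/eqP ? _]; [left|right].
have i3 : k = i \/ k = i' by case: e3 => /andP[/eqP ? _]; [left|right].
have i4 : k' = i \/ k' = i' by case: e4 => /andP[/eqP ? _]; [left|right].
by split => //; lia.
Qed.

(** * Orthogonality and bounded second moments of the degree-two products *)

Section chaos_moments.
Variables (d : measure_display) (T : measurableType d) (R : realType).
Variables (P : probability T R) (E : nat -> nat -> {RV P >-> R}) (sigma : R).
Hypothesis hind : mutually_independent (fun ij : nat * nat => E ij.1 ij.2).
Hypothesis hid :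
  identically_distributed (fun ij : nat * nat => E ij.1 ij.2) (E 0%N 0%N).
Hypothesis h4 : P.-integrable setT (EFin \o (fun t => E 0%N 0%N t ^+ 4)).
Hypothesis hmean : ('E_P[E 0%N 0%N] = 0)%E.
Hypothesis hvar : ('V_P[E 0%N 0%N] = (sigma ^+ 2)%:E)%E.

Let q := centered_poly R (sigma ^+ 2).
Let phi := chaos _ _ _ _ E (sigma ^+ 2).
Let X (p : nat * nat) := E p.1 p.2.

Let mq2 k l : measurable_fun setT (fun x => q k x * q l x).
Proof. by apply: measurable_funM; exact: measurable_centered_poly. Qed.

Let iq2 k l p : P.-integrable setT (EFin \o ((fun x => q k x * q l x) \o X p)).
Proof.
apply: (integrable_identically_distributed _ _ _ _ _ _ _ _ _ hid) => //.
exact: integrable_centered_polyM.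
Qed.

Let supp (i i' j k k' l : nat) :=
  undup [:: (i, j); (i', j); (k, l); (k', l)].

Let phiM i i' j k k' l t : phi i i' j t * phi k k' l t =
  \prod_(p <- supp i i' j k k' l)
     (fun x => q (chaos_deg i i' j p) x * q (chaos_deg k k' l p) x) (X p t).
Proof.
rewrite /phi !(chaosE _ _ _ _ _ _ _ _ _ (supp i i' j k k' l)).
- by rewrite -big_split.
all: by rewrite ?undup_uniq ?mem_undup ?inE ?eqxx ?orbT.
Qed.

Lemma integrable_chaosM i i' j k k' l :
  P.-integrable setT (fun t => (phi i i' j t * phi k k' l t)%:E).
Proof.
under eq_fun do rewrite phiM.
by apply: (integrable_prod_indep _ _ _ P _ X _
  (fun p x => q (chaos_deg i i' j p) x * q (chaos_deg k k' l p) x)) => //;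
  rewrite ?undup_uniq.
Qed.

Let integral_phiM i i' j k k' l :
  (\int[P]_t (phi i i' j t * phi k k' l t)%:E =
  \prod_(p <- supp i i' j k k' l)
   \int[P]_t (q (chaos_deg i i' j p) (X p t) * q (chaos_deg k k' l p) (X p t))%:E)%E.
Proof.
under eq_integral do rewrite phiM.
by apply: (integral_prod_indep _ _ _ P _ X _
  (fun p x => q (chaos_deg i i' j p) x * q (chaos_deg k k' l p) x)) => //;
  rewrite ?undup_uniq.
Qed.

Let integral_q2 a b p : (\int[P]_t (q a (X p t) * q b (X p t))%:E =
  \int[P]_t (q a (E 0%N 0%N t) * q b (E 0%N 0%N t))%:E)%E.
Proof.
apply: (integral_identically_distributed _ _ _ P _ X _ p
  (fun x => q a x * q b x)) => //.
exact: integrable_centered_polyM.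
Qed.

Lemma chaos_orthogonal i i' j k k' l : (i <= i')%N -> (k <= k')%N ->
  (i, i', j) != (k, k', l) ->
  (\int[P]_t (phi i i' j t * phi k k' l t)%:E = 0)%E.
Proof.
move=> ii' kk' neq; rewrite integral_phiM.
(* If no entry occurred in exactly one of the two terms, their supports would coincide,
   contradicting [neq] by [chaos_support_inj]. *)
have [p ps pn] : exists2 p, p \in supp i i' j k k' l &
    (chaos_deg i i' j p == 0%N) != (chaos_deg k k' l p == 0%N).
  case: (boolP (has (fun p => (chaos_deg i i' j p == 0%N) !=
      (chaos_deg k k' l p == 0%N)) (supp i i' j k k' l))).
    by move=> /hasP[p ps pn]; exists p.
  move=> /hasPn h; exfalso; move/eqP: neq; apply.
  suff /(chaos_support_inj _ _ _ _ _ _ ii' kk')[-> -> ->] :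
    [:: (i, j); (i', j)] =i [:: (k, l); (k', l)] by [].
  move=> p; have [/h|] := boolP (p \in supp i i' j k k' l).
    by rewrite negbK !chaos_deg_eq0 => /eqP/negb_inj.
  by rewrite mem_undup !inE !negb_or => /and4P[/negbTE-> /negbTE-> /negbTE-> /negbTE->].
rewrite (bigD1_seq p) ?undup_uniq//= integral_q2.
have -> : (\int[P]_t (q (chaos_deg i i' j p) (E 0%N 0%N t) *
    q (chaos_deg k k' l p) (E 0%N 0%N t))%:E = 0)%E; last by rewrite mul0e.
have iq := integral_centered_poly_eq0 _ _ _ _ _ _ h4 hmean hvar.
(* One of the two degrees at [p] is 0, so the factor at [p] is the mean of a centered polynomial. *)
case: (posnP (chaos_deg i i' j p)) pn => [-> /= pn|dp pn].
  under eq_integral do rewrite mul1r.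
  by apply: iq; rewrite lt0n; move: pn; case: (chaos_deg k k' l p).
have -> : chaos_deg k k' l p = 0%N.
  by apply/eqP; move: pn; case: (chaos_deg k k' l p).
under eq_integral do rewrite mulr1.
exact: iq.
Qed.

(** The summands are the second moments of a diagonal term [E_ij^2 - sigma^2] and of an off-diagonal
    product; their sum dominates both cases at once. *)
Definition chaos_bound : R :=
  fine (\int[P]_t (q 2 (E 0%N 0%N t) * q 2 (E 0%N 0%N t))%:E)%E +
  fine (\int[P]_t (q 1 (E 0%N 0%N t) * q 1 (E 0%N 0%N t))%:E)%E ^+ 2.

Lemma chaos_second_moment_le i i' j :
  (\int[P]_t (phi i i' j t * phi i i' j t)%:E <= chaos_bound%:E)%E.
Proof.
have fin k : (\int[P]_t (q k (E 0%N 0%N t) * q k (E 0%N 0%N t))%:E)%E \is a fin_num.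
  by have /integrable_fin_num := iq2 k k (0%N, 0%N); apply.
have ge0 k : (0 <= \int[P]_t (q k (E 0%N 0%N t) * q k (E 0%N 0%N t))%:E)%E.
  by apply: integral_ge0 => t _; rewrite lee_fin -expr2 sqr_ge0.
rewrite integral_phiM.
under eq_bigr do rewrite integral_q2.
have -> : supp i i' j i i' j = undup [:: (i, j); (i', j)].
  by rewrite /supp /= !inE !eqxx ?orbT /=.
have [<-|ii'] := eqVneq i i'.
  rewrite /= inE eqxx /= big_seq1 /chaos_deg eqxx /=.
  rewrite -[X in (X <= _)%E]fineK; last exact: (fin 2%N).
  by rewrite lee_fin lerDl sqr_ge0.
have ii2 : ((i, j) == (i', j)) = false by rewrite xpair_eqE (negbTE ii').
rewrite /= inE ii2 /= big_cons big_seq1 /chaos_deg !eqxx ii2 eq_sym ii2 /=.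
rewrite -[X in (X <= _)%E]fineK; last by apply: fin_numM; exact: (fin 1%N).
rewrite lee_fin fineM ?(fin 1%N)// -expr2 lerDr.
by rewrite fine_ge0.
Qed.

End chaos_moments.

(** * Deviation of the quadratic form from its mean *)

Lemma sumsqE (R : realType) (u : nat -> R) (n : nat) :
  sumsq u n = \sum_(i < n) u i.+1 ^+ 2.
Proof. by rewrite /sumsq big_add1 /= big_mkord. Qed.

Lemma sumsq_ge0 (R : realType) (u : nat -> R) (n : nat) : 0 <= sumsq u n.
Proof. by rewrite sumsqE; apply: sumr_ge0 => i _; exact: sqr_ge0. Qed.

Lemma sumsqB (R : realType) (u : nat -> R) (a n : nat) : (a <= n)%N ->
  sumsq u n - sumsq u a = \sum_(i < n | (a <= i)%N) u i.+1 ^+ 2.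
Proof.
move=> an; rewrite !sumsqE (big_ord_widen _ (fun i => u i.+1 ^+ 2) an).
rewrite (bigID (fun i : 'I_n => (i < a)%N)) /= addrC addrK.
by apply: eq_bigl => i; rewrite -leqNgt.
Qed.

(** The [D_n] of the overview, left unnormalized so that [D_n] and [D_a] are combinations of the
    same products. *)
Definition deviation d (T : measurableType d) (R : realType)
    (P : probability T R) (E : nat -> nat -> {RV P >-> R}) (u : nat -> R)
    (s : R) (n : nat) (t : T) : R :=
  \sum_(j < n) ((\sum_(i < n) u i.+1 * E i j t) ^+ 2 - s * sumsq u n).

Lemma quadformE d (T : measurableType d) (R : realType)
    (P : probability T R) (E : nat -> nat -> {RV P >-> R}) (u : nat -> R)
    (s : R) (n : nat) (t : T) : (0 < n)%N -> 0 < sumsq u n ->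
  quadform E u n t - s = deviation _ _ _ _ E u s n t / (n%:R * sumsq u n).
Proof.
move=> n0 S0.
have n0' : (0 : R) < n%:R by rewrite ltr0n.
have nS : n%:R * sumsq u n != 0 by rewrite mulf_neq0 ?gt_eqF.
rewrite /deviation sumrB sumr_const card_ord mulrBl.
have -> : s * sumsq u n *+ n / (n%:R * sumsq u n) = s.
  by rewrite -mulr_natr -(mulrA s) (mulrC (sumsq u n)) mulfK.
congr (_ - _).
set v := (utilde u n)^T *m Emat E n t.
have -> : quadform E u n t = (v *m v^T) ord0 ord0.
  by rewrite /quadform -!mulmxA -/v /v trmx_mul trmxK mulmxA.
rewrite mxE mulr_suml; apply: eq_bigr => j _.
rewrite [X in _ * X]mxE -expr2.
have -> : v ord0 j = (Num.sqrt (sumsq u n))^-1 * (Num.sqrt n%:R)^-1 *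
    \sum_(i < n) u i.+1 * E i j t.
  by rewrite mxE mulr_sumr; apply: eq_bigr => i _; rewrite !mxE mulrACA.
rewrite exprMn mulrC; congr (_ * _).
by rewrite exprMn !exprVn !sqr_sqrtr ?(ltW S0)// -invfM mulrC.
Qed.

Lemma sqr_sum_expand (R : realType) (u e : nat -> R) (s : R) (n : nat) :
  (\sum_(i < n) u i * e i) ^+ 2 - s * \sum_(i < n) u i ^+ 2 =
  \sum_(i' < n) \sum_(i < i'.+1) (if (i : nat) == i' then 1 else 2) * u i * u i' *
    (if (i : nat) == i' then e i ^+ 2 - s else e i * e i').
Proof.
elim: n => [|n ih]; first by rewrite !big_ord0 mulr0 subr0 expr0n.
rewrite !big_ord_recr /= -ih eqxx.
rewrite [X in _ = _ + (X + _)](eq_bigr (fun i : 'I_n => (u i * e i) * (2 * u n * e n))).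
  by rewrite -mulr_suml; ring.
move=> i _; rewrite ltn_eqF//; ring.
Qed.

(** Vanishing outside the range of [D_n] lets [D_n] and [D_a] be summed over one common cube of
    indices and subtracted coefficientwise. The 2 counts each cross term of the square twice. *)
Definition deviation_coef (R : realType) (u : nat -> R) (n i i' j : nat) : R :=
  if [&& (i <= i')%N, (i' < n)%N & (j < n)%N]
  then (if i == i' then 1 else 2) * u i.+1 * u i'.+1 else 0.

Lemma deviation_chaosE d (T : measurableType d) (R : realType)
    (P : probability T R) (E : nat -> nat -> {RV P >-> R}) (u : nat -> R)
    (s : R) (n N : nat) (t : T) : (n <= N)%N ->
  deviation _ _ _ _ E u s n t = \sum_(x : 'I_N * 'I_N * 'I_N)
    deviation_coef R u n x.1.1 x.1.2 x.2 * chaos _ _ _ _ E s x.1.1 x.1.2 x.2 t.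
Proof.
move=> nN.
pose F (i i' j : nat) := (if i == i' then 1 else 2) * u i.+1 * u i'.+1 *
  chaos _ _ _ _ E s i i' j t.
transitivity (\sum_(j < n) \sum_(i' < n) \sum_(i < i'.+1) F i i' j).
  apply: eq_bigr => j _; rewrite sumsqE.
  exact: (sqr_sum_expand _ (fun i => u i.+1) (fun i => E i j t)).
rewrite (big_ord_widen _ (fun j => \sum_(i' < n) \sum_(i < i'.+1) F i i' j) nN).
transitivity (\sum_(j < N) \sum_(i' < N) \sum_(i < N)
    if [&& (i <= i')%N, (i' < n)%N & (j < n)%N] then F i i' j else 0).
  rewrite big_mkcond; apply: eq_bigr => j _.
  case: (ltnP j n) => jn; last first.
    by rewrite big1// => i' _; rewrite big1// => i _; rewrite !andbF.
  rewrite (big_ord_widen _ (fun i' => \sum_(i < i'.+1) F i i' j) nN) big_mkcond.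
  apply: eq_bigr => i' _; case: (ltnP i' n) => i'n; last first.
    by rewrite big1// => i _; rewrite andbF.
  rewrite (big_ord_widen _ (fun i => F i i' j) (ltn_ord i')) big_mkcond.
  by apply: eq_bigr => i _; rewrite ltnS !andbT.
rewrite exchange_big /= (eq_bigr _ (fun i' _ => exchange_big _ _ _ _ _ _)) /=.
rewrite exchange_big /= pair_big pair_big /=; apply: eq_bigr => -[[i i'] j] _ /=.
by rewrite /deviation_coef /F; case: ifP => _ //; rewrite mul0r.
Qed.

Lemma sum_triple_prod (R : realType) (I J K : finType) (f : I -> R)
    (g : J -> R) (h : K -> R) :
  \sum_(x : I * J * K) f x.1.1 * g x.1.2 * h x.2 =
  (\sum_i f i) * (\sum_j g j) * (\sum_k h k).
Proof.
rewrite [X in X * _]big_distrlr /= pair_big big_distrlr /= pair_big /=.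
by apply: eq_bigr => -[[i j] k].
Qed.

(** The two coefficients cancel unless [a <= j] or [a <= i'], and the indicator of this union is at
    most the sum of the two indicators. The 4 is the square of the off-diagonal factor 2. *)
Lemma deviation_coef_sqr_le (R : realType) (u : nat -> R) (a n i i' j : nat) :
  (a <= n)%N -> (i' < n)%N -> (j < n)%N ->
  (deviation_coef R u n i i' j - deviation_coef R u a i i' j) ^+ 2 <=
  4 * (u i.+1 ^+ 2 * u i'.+1 ^+ 2 * (a <= j)%N%:R +
       u i.+1 ^+ 2 * (u i'.+1 ^+ 2 * (a <= i')%N%:R) * 1).
Proof.
move=> an i'n jn; rewrite /deviation_coef i'n jn !andbT mulr1.
set w := if i == i' then 1 else 2.
have w4 : w ^+ 2 <= 4 by rewrite /w; case: ifP => _; lra.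
set A := u i.+1; set B := u i'.+1.
have A2 : 0 <= A ^+ 2 * B ^+ 2 by rewrite mulr_ge0 ?sqr_ge0.
have r0 : 0 <= 4 * (A ^+ 2 * B ^+ 2 * (a <= j)%N%:R +
       A ^+ 2 * (B ^+ 2 * (a <= i')%N%:R)).
  by rewrite mulr_ge0// mulrA -mulrDr mulr_ge0// addr_ge0.
case: (leqP i i') => /= _; last by rewrite subrr expr0n.
case: (ltnP i' a) => /= ia; case: (ltnP j a) => /= ja; rewrite ?subrr ?expr0n//=.
all: rewrite ?mulr0 ?mulr1 ?addr0 ?add0r ?subr0 ?exprMn -?mulrA.
all: by nra.
Qed.

(** Both parts of the pointwise majorant are products of functions of [i], [i'] and [j], so their
    sums over the cube factor. *)
Lemma sum_deviation_coef_sqr_le (R : realType) (u : nat -> R) (a n : nat) :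
  (a <= n)%N ->
  \sum_(x : 'I_n * 'I_n * 'I_n) (deviation_coef R u n x.1.1 x.1.2 x.2 -
     deviation_coef R u a x.1.1 x.1.2 x.2) ^+ 2 <=
  4 * ((n - a)%:R * sumsq u n ^+ 2 +
       n%:R * (sumsq u n * (sumsq u n - sumsq u a))).
Proof.
move=> an.
apply: (@le_trans _ _ (\sum_(x : 'I_n * 'I_n * 'I_n)
    4 * (u x.1.1.+1 ^+ 2 * u x.1.2.+1 ^+ 2 * (a <= x.2)%N%:R +
      u x.1.1.+1 ^+ 2 * (u x.1.2.+1 ^+ 2 * (a <= x.1.2)%N%:R) * 1))).
  by apply: ler_sum => x _; exact: deviation_coef_sqr_le.
rewrite -mulr_sumr ler_pM2l// big_split /=.
rewrite (sum_triple_prod _ _ _ _ (fun i : 'I_n => u i.+1 ^+ 2)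
  (fun i : 'I_n => u i.+1 ^+ 2) (fun j : 'I_n => (a <= j)%N%:R)).
rewrite (sum_triple_prod _ _ _ _ (fun i : 'I_n => u i.+1 ^+ 2)
  (fun i : 'I_n => u i.+1 ^+ 2 * (a <= i)%N%:R) (fun j : 'I_n => 1)).
rewrite sumr_const card_ord sumsqB//.
have -> : \sum_(i < n) (a <= i)%N%:R = (n - a)%:R :> R.

  (* With unit weights [sumsq] counts indices, so [sumsqB] also gives the cardinality. *)
  have S1 m : sumsq (fun=> 1 : R) m = m%:R.
    by rewrite sumsqE; under eq_bigr do rewrite expr1n; rewrite sumr_const card_ord.
  rewrite natrB// -!S1 sumsqB// [RHS]big_mkcond.
  by apply: eq_bigr => i _; rewrite expr1n; case: ifP.
rewrite -sumsqE.
have -> : \sum_(i < n) u i.+1 ^+ 2 * (a <= i)%N%:R =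
    \sum_(i < n | (a <= i)%N) u i.+1 ^+ 2.
  by rewrite [RHS]big_mkcond; apply: eq_bigr => i _; case: ifP; rewrite ?mulr1 ?mulr0.
by rewrite -expr2 mulrC [X in _ + X]mulrC.
Qed.

Lemma measurable_deviation d (T : measurableType d) (R : realType)
    (P : probability T R) (E : nat -> nat -> {RV P >-> R}) (u : nat -> R)
    (s : R) (n : nat) :
  measurable_fun setT (deviation _ _ _ _ E u s n).
Proof.
apply: measurable_sum => j; apply: measurable_funB => //.
apply: measurable_funX; apply: measurable_sum => i.
by apply: measurable_funM => //; exact: measurable_funPT.
Qed.

(** * Second moments of the increments of the deviation *)

Section deviation_moments.
Variables (d : measure_display) (T : measurableType d) (R : realType).
Variables (P : probability T R) (E : nat -> nat -> {RV P >-> R}) (sigma : R).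
Variable u : nat -> R.
Hypothesis hind : mutually_independent (fun ij : nat * nat => E ij.1 ij.2).
Hypothesis hid :
  identically_distributed (fun ij : nat * nat => E ij.1 ij.2) (E 0%N 0%N).
Hypothesis h4 : P.-integrable setT (EFin \o (fun t => E 0%N 0%N t ^+ 4)).
Hypothesis hmean : ('E_P[E 0%N 0%N] = 0)%E.
Hypothesis hvar : ('V_P[E 0%N 0%N] = (sigma ^+ 2)%:E)%E.

Let dev := deviation _ _ _ _ E u (sigma ^+ 2).
Let K := chaos_bound _ _ _ P E sigma.

Lemma chaos_bound_ge0 : 0 <= K.
Proof.
rewrite addr_ge0 ?sqr_ge0// fine_ge0// integral_ge0// => t _.
by rewrite lee_fin -expr2 sqr_ge0.
Qed.

Lemma deviation_gap_second_moment_le (a n : nat) : (a <= n)%N ->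
  (\int[P]_t ((dev n t - dev a t) ^+ 2)%:E <=
   (K * (4 * ((n - a)%:R * sumsq u n ^+ 2 +
      n%:R * (sumsq u n * (sumsq u n - sumsq u a)))))%:E)%E.
Proof.
move=> an.
pose c (x : 'I_n * 'I_n * 'I_n) := deviation_coef R u n x.1.1 x.1.2 x.2 -
  deviation_coef R u a x.1.1 x.1.2 x.2.
pose phi (x : 'I_n * 'I_n * 'I_n) :=
  chaos _ _ _ _ E (sigma ^+ 2) x.1.1 x.1.2 x.2.
have devE t : dev n t - dev a t = \sum_x c x * phi x t.
  rewrite /dev (deviation_chaosE _ _ _ _ _ _ _ _ n _ (leqnn n)).
  rewrite (deviation_chaosE _ _ _ _ _ _ _ _ n _ an) -sumrB.
  by apply: eq_bigr => x _; rewrite -mulrBl.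
(* Nonzero coefficients occur only for [i <= i'], the range where distinct products are
   orthogonal. *)
have c_le x : c x != 0 -> (x.1.1 <= x.1.2)%N.
  by rewrite /c /deviation_coef; case: (leqP x.1.1 x.1.2) => //=; rewrite subrr eqxx.
under eq_integral do rewrite devE.
apply: (@le_trans _ _ (K * \sum_x c x ^+ 2)%:E).
  apply: orthogonal_second_moment_le => [x y|x y cx cy xy|x].
  - exact: integrable_chaosM.
  - apply: (chaos_orthogonal _ _ _ _ _ _ hind hid h4 hmean hvar).
    + exact: c_le.
    + exact: c_le.
    apply: contra xy; case: x {cx} => [[i i'] j]; case: y {cy} => [[k k'] l] /=.
    by move=> /eqP[ik ik' jl]; rewrite !xpair_eqE -!val_eqE /= ik ik' jl !eqxx.
  - exact: chaos_second_moment_le.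
by rewrite lee_fin ler_wpM2l ?chaos_bound_ge0// sum_deviation_coef_sqr_le.
Qed.

Lemma normalized_gap_second_moment_le (a n : nat) : (a <= n)%N -> (0 < n)%N ->
  0 < sumsq u n ->
  (\int[P]_t (((dev n t - dev a t) / (n%:R * sumsq u n)) ^+ 2)%:E <=
   (4 * K * ((n%:R - a%:R) / n%:R ^+ 2 +
      (sumsq u n - sumsq u a) / sumsq u n / n%:R))%:E)%E.
Proof.
move=> an n0 S0.
have n0' : (0 : R) < n%:R by rewrite ltr0n.
have mdev : measurable_fun setT (fun t => (dev n t - dev a t) ^+ 2).
  by apply: measurable_funX; apply: measurable_funB; exact: measurable_deviation.
under eq_integral do rewrite exprMn mulrC EFinM.
rewrite ge0_integralZl//; last 3 first.
- exact/measurable_EFinP.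
- by move=> t _; rewrite lee_fin sqr_ge0.
- by rewrite lee_fin sqr_ge0.
apply: (@le_trans _ _ ((n%:R * sumsq u n)^-1 ^+ 2 *
   (K * (4 * ((n - a)%:R * sumsq u n ^+ 2 +
      n%:R * (sumsq u n * (sumsq u n - sumsq u a))))))%:E).
  rewrite [X in (_ <= X)%E]EFinM lee_wpmul2l//; first by rewrite lee_fin sqr_ge0.
  exact: deviation_gap_second_moment_le.
rewrite lee_fin natrB// le_eqVlt; apply/orP; left; apply/eqP.
by field; rewrite !gt_eqF.
Qed.

End deviation_moments.

(** * The subsequence floor(k^beta) *)

Definition anchor (R : realType) (beta : R) (k : nat) : nat :=
  Num.truncn (powR (k%:R : R) beta).

Definition root_index (R : realType) (beta : R) (M : nat) : nat :=
  Num.truncn (powR (M%:R : R) beta^-1).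

Lemma powR_root_index_le (R : realType) (beta : R) (M : nat) : 0 < beta ->
  ((root_index R beta M)%:R : R) `^ beta <= M%:R.
Proof.
move=> b0.
have -> : (M%:R : R) = (M%:R `^ beta^-1) `^ beta.
  by rewrite -powRrM mulVf ?gt_eqF// powRr1.
apply: ge0_ler_powR; rewrite ?nnegrE ?powR_ge0 ?ler0n ?(ltW b0)//.
by rewrite /root_index truncn_le powR_ge0.
Qed.

Lemma anchor_le (R : realType) (beta : R) (M : nat) : 0 < beta ->
  (anchor R beta (root_index R beta M) <= M)%N.
Proof.
move=> b0; rewrite -(ler_nat R); apply: le_trans (powR_root_index_le R beta M b0).
by rewrite /anchor truncn_le powR_ge0.
Qed.

Lemma root_index_gt0 (R : realType) (beta : R) (M : nat) : 0 < beta ->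
  (0 < M)%N -> (0 < root_index R beta M)%N.
Proof.
move=> b0 M0; rewrite /root_index truncn_gt0.
apply: (@le_trans _ _ (1 `^ beta^-1)); first by rewrite powR1.
apply: ge0_ler_powR; rewrite ?nnegrE ?invr_ge0 ?(ltW b0) ?ler0n//.
by rewrite ler1n.
Qed.

Lemma anchor_gt0 (R : realType) (beta : R) (k : nat) : 0 < beta ->
  (0 < k)%N -> (0 < anchor R beta k)%N.
Proof.
move=> b0 k0; rewrite /anchor truncn_gt0.
apply: (@le_trans _ _ (1 `^ beta)); first by rewrite powR1.
apply: ge0_ler_powR; rewrite ?nnegrE ?(ltW b0) ?ler0n//.
by rewrite ler1n.
Qed.

(** [M^(1/beta) - 1] lies below the integer part of [M^(1/beta)]. This gives both [B <= a] and the
    estimate of [M - a]. *)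
Lemma powR_root_sub1_le (R : realType) (beta : R) (M : nat) : 0 < beta ->
  (0 < M)%N ->
  ((M%:R : R) `^ beta^-1 - 1) `^ beta <= (root_index R beta M)%:R `^ beta.
Proof.
move=> b0 M0.
have x1 : 1 <= (M%:R : R) `^ beta^-1.
  by rewrite -truncn_gt0; exact: root_index_gt0.
apply: ge0_ler_powR; rewrite ?nnegrE ?subr_ge0 ?ler0n ?(ltW b0)//.
rewrite lerBlDr natr1 ltW// /root_index truncnS_gt//.
Qed.

Lemma Bidx_le_anchor (R : realType) (beta : R) (M : nat) : 0 < beta ->
  (0 < M)%N -> (Bidx beta M <= (anchor R beta (root_index R beta M))%:Z)%R.
Proof.
move=> b0 M0; rewrite /Bidx /anchor.
apply: (le_trans (le_floor (powR_root_sub1_le R beta M b0 M0))).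
by rewrite truncn_floor powR_ge0 gez0_abs// floor_ge0 powR_ge0.
Qed.

(** With [y = M^(1/beta)], the anchor plus 1 is at least [(y - 1)^beta = M (1 - 1/y)^beta], hence at
    least [M - b M / y] by Bernoulli. The 1 is absorbed by [M / y >= 1], whence the constant
    [b + 1]. *)
Lemma sub_anchor_le (R : realType) (beta : R) (b M : nat) : 1 <= beta ->
  beta <= b%:R -> (0 < M)%N ->
  M%:R - (anchor R beta (root_index R beta M))%:R <=
  (b%:R + 1) * (M%:R : R) `^ (1 - beta^-1).
Proof.
move=> b1 bb M0.
have b0 : 0 < beta by exact: lt_le_trans b1.
have M0' : (0 : R) < M%:R by rewrite ltr0n.
have M1 : (1 : R) <= M%:R by rewrite ler1n.
set y := (M%:R : R) `^ beta^-1.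
have y1 : 1 <= y by rewrite -truncn_gt0; exact: root_index_gt0.
have y0 : 0 < y by exact: lt_le_trans y1.
have yM : y `^ beta = M%:R by rewrite -powRrM mulVf ?gt_eqF// powRr1// ltW.
have x01 : 0 <= y^-1 <= 1 by rewrite invr_ge0 (ltW y0) invf_le1.
have bern := bernoulli_powR R y^-1 beta b x01 _.
have -> : (M%:R : R) `^ (1 - beta^-1) = M%:R / y.
  rewrite powRB; last by rewrite (gt_eqF M0') implybT.
  by rewrite powRr1// ltW.
have My : 1 <= M%:R / y.
  rewrite ler_pdivlMr// mul1r; apply: ler1_powR => //.
  by rewrite invf_le1.
have key : M%:R * (1 - b%:R * y^-1) <= (anchor R beta (root_index R beta M))%:R + 1.
  apply: (@le_trans _ _ ((y - 1) `^ beta)).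
    have -> : y - 1 = y * (1 - y^-1) by rewrite mulrBr mulr1 divff ?gt_eqF.
    rewrite powRM ?(ltW y0)//; last by rewrite subr_ge0; case/andP: x01.
    by rewrite yM ler_pM2l// bern// b0.
  apply: (le_trans (powR_root_sub1_le R beta M b0 M0)).
  by rewrite natr1 ltW// truncnS_gt.
move: key; rewrite mulrBr mulr1 mulrCA; lra.
Qed.

(** The difference runs over the indices from [a + 1] to [M], all of them at least [B]. *)
Lemma sumsq_sub_le_tailsq (R : realType) (u : nat -> R) (beta : R) (a M : nat) :
  (Bidx beta M <= a%:Z)%R -> (a <= M)%N ->
  sumsq u M - sumsq u a <= tailsq u beta M.
Proof.
move=> Ba aM; rewrite sumsqB// /tailsq big_add1 /= big_mkord.
rewrite big_mkcond [leRHS]big_mkcond; apply: ler_sum => i _.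
case: ifP => ai; last by case: ifP => // _; rewrite sqr_ge0.
by rewrite (le_trans Ba)// lez_nat ltnW.
Qed.

Lemma cvg_root_index (R : realType) (beta : R) : 0 < beta ->
  root_index R beta M @[M --> \oo] --> \oo.
Proof.
move=> b0; apply/cvgnyPge => n.
near=> M.
have nM : (n%:R : R) `^ beta <= M%:R.
  near: M; exact: nbhs_infty_ger.
rewrite /root_index -(@natrK R n) le_truncn//.
have -> : (n%:R : R) = (n%:R `^ beta) `^ beta^-1.
  by rewrite -powRrM mulfV ?gt_eqF// powRr1.
by apply: ge0_ler_powR; rewrite ?nnegrE ?powR_ge0 ?ler0n ?invr_ge0 ?(ltW b0).
Unshelve. all: by end_near. Qed.

(** * Almost sure convergence along the subsequence and across the gaps *)

Theorem theorem5 (R : realType) (u : nat -> R)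
  (hpos : forall M : nat, (1 <= M)%N -> 0 < sumsq u M)
  (htail : exists (beta beta' c : R), 1 < beta /\ 0 < beta' /\ 0 < c /\
     forall M : nat, (1 <= M)%N ->
       tailsq u beta M / sumsq u M <= c / powR (M%:R) beta')
  (d : measure_display) (T : measurableType d) (P : probability T R)
  (E : nat -> nat -> {RV P >-> R}) (sigma : R)
  (hind : mutually_independent (fun ij : nat * nat => E ij.1 ij.2))
  (hid : identically_distributed (fun ij : nat * nat => E ij.1 ij.2) (E 0%N 0%N))
  (h4 : P.-integrable setT (EFin \o (fun t => E 0%N 0%N t ^+ 4)))
  (hmean : ('E_P[E 0%N 0%N] = 0)%E)
  (hvar : ('V_P[E 0%N 0%N] = (sigma ^+ 2)%:E)%E) :
  {ae P, forall t, quadform E u M t @[M --> \oo] --> sigma ^+ 2}.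
Proof.
case: htail => beta [beta' [c [b1 [b'0 [c0 tail]]]]].
have b0 : 0 < beta by exact: lt_trans b1.
pose dev := deviation _ _ _ _ E u (sigma ^+ 2).
pose K := chaos_bound _ _ _ P E sigma.
have K0 : 0 <= K by exact: chaos_bound_ge0.
pose N (n : nat) : R := n%:R * sumsq u n.
pose k M := root_index R beta M.
pose a M := anchor R beta (k M).
(* An integer above [beta], to serve as the exponent in Bernoulli's inequality. *)
pose b := (Num.truncn beta).+1.
have bb : beta <= b%:R by rewrite ltW// truncnS_gt.
have gap := normalized_gap_second_moment_le _ _ _ _ _ _ u hind hid h4 hmean hvar.
pose Z n t := dev (anchor R beta n) t / N (anchor R beta n).
pose W M t := (dev M t - dev (a M) t) / N M.
have dev0 t : dev 0%N t = 0 by rewrite /dev /deviation big_ord0.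
have mdev n : measurable_fun setT (dev n) by exact: measurable_deviation.
have S00 : sumsq u 0 = 0 by rewrite sumsqE big_ord0.
have Zcvg : {ae P, forall t, Z n t @[n --> \oo] --> (0 : R)}.
  (* The gap bound from 0 to [m = anchor R beta n] is [8 K / m], and [1 / m <= 2 / n^beta]. The
     exponent is written in the form of the p-series lemma. *)
  pose v (n : nat) := 16 * K * (n%:R : R) `^ (- (1 + (beta - 1))).
  apply: (ae_cvg0_summable_second_moment _ _ _ _ _ v).
  - by move=> n; apply: measurable_funM.
  - case=> [|n].
      rewrite /Z (_ : anchor R beta 0 = 0%N); last first.
        by rewrite /anchor powR0 ?gt_eqF// truncn0.
      under eq_integral do rewrite dev0 mul0r expr0n.
      by rewrite integral0 lee_fin !mulr_ge0 ?powR_ge0.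
    set m := anchor R beta n.+1.
    have m0 : (0 < m)%N by exact: anchor_gt0.
    have m1 : (1 : R) <= m%:R by rewrite ler1n.
    have m0' : (0 : R) < m%:R by rewrite ltr0n.
    have Sm := hpos m m0.
    have := gap 0%N m (leq0n _) m0 Sm.
    under eq_integral do rewrite -/dev dev0 subr0.
    move=> h; apply: (le_trans h); rewrite lee_fin S00 !subr0 divff ?gt_eqF//.
    rewrite -/K /v addrCA subrr addr0 powRN; set q := n.+1%:R `^ beta.
    have q0 : 0 < q by rewrite powR_gt0// ltr0n.
    (* From [q < m + 1] and [m >= 1]. *)
    have qm : q <= m%:R * 2.
      have : q < m%:R + 1 by rewrite natr1; exact: truncnS_gt.
      lra.
    have mq : m%:R^-1 <= 2 / q by rewrite ler_pdivlMr// mulrC ler_pdivrMr// mulrC.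
    have -> : m%:R / m%:R ^+ 2 + 1 / m%:R = 2 * (m%:R : R)^-1.
      by field; rewrite gt_eqF.
    have -> : 16 * K / q = 4 * K * (2 * (2 / q)) by field; rewrite gt_eqF.
    by rewrite ler_wpM2l ?mulr_ge0// ler_pM2l.
  - apply: is_cvg_seriesZ; apply: is_cvg_series_powR; lra.
have Wcvg : {ae P, forall t, W n t @[n --> \oo] --> (0 : R)}.
  (* The first term is [sub_anchor_le] divided by [n^2], the second the tail hypothesis divided by
     [n]. *)
  pose v (n : nat) := 4 * K * ((b%:R + 1) * (n%:R : R) `^ (- (1 + beta^-1))
    + c * (n%:R : R) `^ (- (1 + beta'))).
  apply: (ae_cvg0_summable_second_moment _ _ _ _ _ v).
  - by move=> n; apply: measurable_funM => //; exact: measurable_funB.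
  - case=> [|n].
      (* At index 0 the denominator is 0 and the quotient takes the default value 0. *)
      under eq_integral do rewrite /W /N mul0r invr0 mulr0 expr0n.
      rewrite integral0 lee_fin /v.
      by rewrite mulr_ge0 ?addr_ge0 ?mulr_ge0 ?powR_ge0 ?(ltW c0).
    set m := n.+1.
    have m0 : (0 < m)%N by [].
    have m0' : (0 : R) < m%:R by rewrite ltr0n.
    have Sm := hpos m m0.
    have am : (a m <= m)%N by exact: anchor_le.
    apply: (le_trans (gap _ _ am m0 Sm)); rewrite lee_fin.
    rewrite ler_wpM2l ?mulr_ge0// lerD//.
    + have -> : (m%:R : R) `^ (- (1 + beta^-1)) = m%:R `^ (1 - beta^-1) / m%:R ^+ 2.
        rewrite -powR_mulrn ?ler0n// -powRB; last by rewrite (gt_eqF m0') implybT.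
        by congr (_ `^ _); lra.
      rewrite mulrA ler_pM2r ?invr_gt0 ?exprn_gt0//.
      by apply: sub_anchor_le => //; exact: ltW.
    + have -> : (m%:R : R) `^ (- (1 + beta')) = (m%:R `^ beta')^-1 / m%:R.
        rewrite opprD addrC powRD; last by rewrite (gt_eqF m0') implybT.
        by rewrite !powRN powRr1// ltW.
      rewrite mulrA ler_pM2r ?invr_gt0//.
      apply: le_trans (tail m m0); rewrite ler_pM2r ?invr_gt0//.
      by apply: sumsq_sub_le_tailsq => //; exact: Bidx_le_anchor.
  - apply: is_cvg_seriesZ.
    rewrite (_ : (fun n : nat => _) =
      (fun n : nat => (b%:R + 1) * (n%:R : R) `^ (- (1 + beta^-1))) \+
      (fun n : nat => c * (n%:R : R) `^ (- (1 + beta'))))//.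
    apply: is_cvg_seriesD; apply: is_cvg_seriesZ; apply: is_cvg_series_powR => //.
    by rewrite invr_gt0.
apply: filterS2 Zcvg Wcvg => t Zt Wt.
have Zk : Z (k M) t @[M --> \oo] --> (0 : R).
  exact: (cvg_comp (k) (Z ^~ t) (cvg_root_index R beta b0) Zt).
suff : quadform E u M t - sigma ^+ 2 @[M --> \oo] --> (0 : R).
  by move=> h; apply/subr_cvg0.
have Bcvg : `|W M t| + `|Z (k M) t| @[M --> \oo] --> (0 : R).
  have W' : `|W M t| @[M --> \oo] --> (0 : R) by exact/norm_cvg0P.
  have Z' : `|Z (k M) t| @[M --> \oo] --> (0 : R) by exact/norm_cvg0P.
  have := cvgD W' Z'; rewrite addr0; exact.
apply/norm_cvg0P; apply: (squeeze_cvgr _ (cvg_cst 0) Bcvg).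
near=> M; rewrite normr_ge0 /=.
have M0 : (0 < M)%N by near: M; exact: nbhs_infty_gt.
rewrite quadformE ?hpos//.
have k0 : (0 < k M)%N by exact: root_index_gt0.
have a0 : (0 < a M)%N by exact: anchor_gt0.
have aM : (a M <= M)%N by exact: anchor_le.
have NM : 0 < N M by rewrite mulr_gt0 ?ltr0n ?hpos.
have Na : 0 < N (a M) by rewrite mulr_gt0 ?ltr0n ?hpos.
have NaM : N (a M) <= N M.
  rewrite ler_pM ?ler0n ?sumsq_ge0 ?ler_nat//.
  by rewrite -subr_ge0 sumsqB// sumr_ge0// => i _; exact: sqr_ge0.
have -> : deviation d T R P E u (sigma ^+ 2) M t / (M%:R * sumsq u M) =
    W M t + Z (k M) t * (N (a M) / N M).
  by rewrite /W /Z -/(a M) -/(N M) -/dev; field; rewrite !gt_eqF.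
apply: (le_trans (ler_normD _ _)); rewrite lerD2l normrM ler_piMr//.
by rewrite ger0_norm ?divr_ge0 ?(ltW NM) ?(ltW Na)// ler_pdivrMr// mul1r.
Unshelve. all: by end_near. Qed.
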